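(* Let $H$ be a finite linear cycle set with abelian adjoint group, let $I$ be an abelian group with maps $\diamond,\prec$, and let $d_i,e_i,a_j,r_j$ be as in the context. Let $T_1,T_2\colon I^n\oplus I^{sn}\to I^{ns}$, $T_3\colon I^n\oplus I^{sn}\to I^{n\binom s2}$, $S\colon I^n\to I^n\oplus I^{sn}$ and $$T\colon\ker(T_1)\cap\ker(T_2)\cap\ker(T_3)\longrightarrow C^{02}\oplus C^{11},\qquad T\bigl((\gamma_i),(\mathfrak f_{ji})\bigr)=\bigl(\alpha_{\gamma_1,\dots,\gamma_n},-f_{(\mathfrak f_{ji}),(\gamma_i)}\bigr),$$ be the linear maps defined in the context. Then $T$ induces an isomorphism $$\overline T\colon\frac{\ker(T_1)\cap\ker(T_2)\cap\ker(T_3)}{\operatorname{Im}(S)}\longrightarrow \mathrm H^2_{\diamond,\prec}(H,I).$$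
   Context: Linear cycle sets. A linear cycle set is an additive abelian group $H$ with a binary operation $\cdot$ such that each map $l\mapsto h\cdot l$ is bijective and $h\cdot(l+m)=h\cdot l+h\cdot m$, $(h+l)\cdot m=(h\cdot l)\cdot(h\cdot m)$ for all $h,l,m\in H$. The inverse of $l\mapsto h\cdot l$ is written $l\mapsto{}^hl$. Setting $h\times l:=h+{}^hl$ makes $H$ a group with neutral element $0$ (the adjoint group); $h^{\times k}$ denotes powers in this group. Actions. $I$ is an abelian group and $\diamond\colon H\times I\to I$, $\prec\colon I\times H\to I$ are maps such that, writing $y^h:=y-y\prec h$ and $y\triangleleft h:=h\diamond(y-y\prec h)$, for all $h,l\in H$ and $y,z\in I$: $y\triangleleft(h\times l)=(y\triangleleft h)\triangleleft l$, $(y+z)\triangleleft h=y\triangleleft h+z\triangleleft h$, $y\triangleleft 0=y$; $(l\times h)\diamond y=h\diamond(l\diamond y)$, $h\diamond(y+z)=h\diamond y+h\diamond z$, $0\diamond y=y$; $y^{h+l}+y=y^h+y^l$, $0^h=0$. Standing setting. As an additive group $H=\mathbb Z_{d_1}\oplus\cdots\oplus\mathbb Z_{d_n}$, and $e_i\in H$ is the element whose only non-zero coordinate is the $i$-th one, which equals $1$ (so $d_i\ge 2$). The group $(H,\times)$ is abelian and is the direct product of its cyclic subgroups generated by $a_1,\dots,a_s$; $r_j$ is the order of $a_j$ in $(H,\times)$. Put $\bar a_{j\ell}:=a_j^{\times(\ell+1)}-a_j$. Write $a_j=\sum_k\lambda_{kj}e_k$ and $a_j\cdot e_i=\sum_k\Gamma^k_{ij}e_k$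 with $0\le\lambda_{kj},\Gamma^k_{ij}<d_k$. Cohomology. $C^{01}$ is the group of maps $t\colon H\to I$ with $t(0)=0$; $C^{11}$ is the group of maps $g\colon H\times H\to I$ with $g(h,0)=g(0,h)=0$ for all $h$; $C^{02}$ is the subgroup of symmetric maps in $C^{11}$. A pair $(\beta,g)\in C^{02}\oplus C^{11}$ is a $2$-cocycle if for all $h,l,m\in H$: (i) $\beta(l,m)-\beta(h+l,m)+\beta(h,l+m)-\beta(h,l)=0$; (ii) $\beta(h\cdot l,h\cdot m)-h\diamond\beta(l,m)-g(h,m)+g(h,l+m)-g(h,l)=0$; (iii) $g(h\cdot l,h\cdot m)-g(h+l,m)+(h\cdot l)\diamond g(h,m)+\bigl((h\cdot l)\diamond g(h,l)\bigr)\prec\bigl((h+l)\cdot m\bigr)+\bigl((h+l)\diamond\beta(h,l)\bigr)\prec\bigl((h+l)\cdot m\bigr)=0$. It is a $2$-coboundary if there is $t\in C^{01}$ with $\beta(h,l)=t(l)-t(h+l)+t(h)$ and $g(h,l)=t(h\cdot l)-h\diamond t(l)-(l\diamond t(h))\prec(h\cdot l)$ for all $h,l$. $\mathrm H^2_{\diamond,\prec}(H,I)$ is the group of $2$-cocycles modulo $2$-coboundaries. The map $\alpha$. For $\gamma_1,\dots,\gamma_n\in I$, $\alpha_{\gamma_1,\dots,\gamma_n}\colon H\times H\to I$ sends $(h,l)$ to $\sum_{i:\,h_i+l_i\ge d_i}\gamma_i$, where $h_i,l_i\in\{0,\dots,d_i-1\}$ represent the $i$-th coordinates of $h,l$. The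 map $f_1$. Given $((\gamma_i),(\mathfrak f_{ji}))\in I^n\oplus I^{sn}$ ($1\le i\le n$, $1\le j\le s$), put $\alpha:=\alpha_{\gamma_1,\dots,\gamma_n}$ and define, for $0\le\lambda_i<d_i$, $$f_1\Bigl(a_j,\sum_{i=1}^n\lambda_ie_i\Bigr):=\sum_{i=1}^n\lambda_i\mathfrak f_{ji}+\sum_{i=1}^n\sum_{\ell=1}^{\lambda_i-1}\alpha\bigl(a_j\cdot e_i,\ell(a_j\cdot e_i)\bigr)+\sum_{k=2}^n\alpha\Bigl(\sum_{i=1}^{k-1}\lambda_i(a_j\cdot e_i),\lambda_k(a_j\cdot e_k)\Bigr).$$ Also put $$F_1(a_j,a_k,d):=f_1(a_k,a_j\cdot d)+a_k\diamond f_1(a_j,d)+\bigl(a_k\diamond f_1(a_j,{}^{a_j}a_k)\bigr)\prec\bigl((a_j\times a_k)\cdot d\bigr)-\bigl((a_j\times a_k)\diamond\alpha(a_j,{}^{a_j}a_k)\bigr)\prec\bigl((a_j\times a_k)\cdot d\bigr).$$ The maps $T_1,T_2,T_3,S$. $T_1((\gamma_i),(\mathfrak f_{ji})):=\Bigl(d_i\mathfrak f_{ji}+\sum_{k=1}^{d_i-1}\alpha(a_j\cdot e_i,k(a_j\cdot e_i))-a_j\diamond\gamma_i\Bigr)_{i,j}$; $T_2((\gamma_i),(\mathfrak f_{ji})):=\Bigl(\sum_{\ell=0}^{r_j-1}a_j^{\times(r_j-1-\ell)}\diamond f_1(a_j,a_j^{\times\ell}\cdot e_i)+\sum_{\ell=1}^{r_j-1}(a_j^{\times\ell}\diamond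 f_1(a_j,\bar a_{j\ell}))\prec e_i-\sum_{\ell=1}^{r_j-1}(a_j^{\times(\ell+1)}\diamond\alpha(a_j,\bar a_{j\ell}))\prec e_i\Bigr)_{i,j}$; $T_3((\gamma_i),(\mathfrak f_{ji})):=\bigl(F_1(a_j,a_i,e_k)-F_1(a_i,a_j,e_k)\bigr)_{i<j,\,k}$; $S(t_1,\dots,t_n):=\bigl((\gamma_i),(\mathfrak f_{ji})\bigr)$ with $\gamma_i=d_it_i$ and $\mathfrak f_{ji}=-\sum_{k=1}^n\Gamma^k_{ij}t_k+a_j\diamond t_i+\sum_{k=1}^n\lambda_{kj}\bigl((e_i\diamond t_k)\prec(a_j\cdot e_i)\bigr)$. The map $f_{(\mathfrak f_{ji}),(\gamma_i)}$. For $((\gamma_i),(\mathfrak f_{ji}))\in\ker T_1\cap\ker T_2\cap\ker T_3$, $f=f_{(\mathfrak f_{ji}),(\gamma_i)}\colon H\times H\to I$ is the unique map with $f(a_j,d)=f_1(a_j,d)$ for all $j$ and $d\in H$, and, for all $l,m,d\in H$, $f(l\times m,d)=f(m,l\cdot d)+m\diamond f(l,d)+\bigl(m\diamond f(l,{}^lm)\bigr)\prec\bigl((l\times m)\cdot d\bigr)-\bigl((l\times m)\diamond\alpha(l,{}^lm)\bigr)\prec\bigl((l\times m)\cdot d\bigr)$ (it is constructed recursively on products of the $a_j$'s; these kernel conditions ensure it is well defined).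
   Formalization: With the printed formulas, the isomorphism is proved assuming every 2-coboundary is a 2-cocycle (false in general, so H² may be undefined); it is also proved unconditionally with l⋄t(h) replaced by h⋄t(h) in coboundaries and e_i⋄t_k by a_j⋄t_k in S. *)

(* Defs.v *)
Set Warnings "-notation-overridden,-ambiguous-paths".
Set Warnings "-redundant-canonical-projection,-projection-no-head-constant".
From HB Require Import structures.
From mathcomp Require Import all_boot all_order all_algebra all_fingroup.
From mathcomp Require Import generic_quotient ring_quotient boolp.

Set Implicit Arguments.
Unset Strict Implicit.
Unset Printing Implicit Defensive.

Import GRing.Theory.
Local Open Scope ring_scope.
Local Open Scope quotient_scope.

Section Differences.
Variable V : zmodType.
Implicit Types x y u v : V.

Lemma subr_eqB x y u u' v v' :
  x = u - u' -> y = v - v' -> x - y = (u - v) - (u' - v').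
Proof. by move=> -> ->; rewrite !opprD !opprK addrACA. Qed.

Lemma addr_eqB x y u u' v v' :
  x = u - u' -> y = v - v' -> x + y = (u + v) - (u' + v').
Proof. by move=> -> ->; rewrite !opprD addrACA. Qed.

Lemma oppr_eqB x u u' : x = u - u' -> - x = - u - - u'.
Proof. by move=> ->; rewrite opprD. Qed.

Lemma sumr_eqB (T : Type) (r : seq T) (P : pred T) (F G K : T -> V) :
    (forall i, F i = G i - K i) ->
  \sum_(i <- r | P i) F i = \sum_(i <- r | P i) G i - \sum_(i <- r | P i) K i.
Proof. by move=> e; rewrite -sumrB; apply: eq_bigr => i _; apply: e. Qed.

Lemma morphB0 (U : zmodType) (f : U -> V) :
  {morph f : x y / x - y} -> f 0 = 0.
Proof. by move=> fB; have := fB 0 0; rewrite !subrr. Qed.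

End Differences.

Section DirectSum.
Variables (n : nat) (d : 'I_n -> nat).

(* Z_{d_1} (+) ... (+) Z_{d_n}.  'Z_m is Z/mZ only for 1 < m, which is assumed
   of every d i in the theorem; the coordinate h i : 'Z_(d i) coerces to its
   representative in {0, ..., d i - 1}. *)
Definition zsum : Type := {dffun forall i : 'I_n, 'Z_(d i)}.

HB.instance Definition _ := Finite.on zsum.

Implicit Types h l m : zsum.

Definition zsum0 : zsum := [ffun i => 0].
Definition zsum_opp h : zsum := [ffun i => - h i].
Definition zsum_add h l : zsum := [ffun i => h i + l i].

Fact zsum_addA : associative zsum_add.
Proof. by move=> h l m; apply/ffunP=> i; rewrite !ffunE addrA. Qed.
Fact zsum_addC : commutative zsum_add.
Proof. by move=> h l; apply/ffunP=> i; rewrite !ffunE addrC. Qed.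
Fact zsum_add0 : left_id zsum0 zsum_add.
Proof. by move=> h; apply/ffunP=> i; rewrite !ffunE add0r. Qed.
Fact zsum_addN : left_inverse zsum0 zsum_opp zsum_add.
Proof. by move=> h; apply/ffunP=> i; rewrite !ffunE addNr. Qed.

HB.instance Definition _ :=
  GRing.isZmodule.Build zsum zsum_addA zsum_addC zsum_add0 zsum_addN.

Definition basis (i : 'I_n) : zsum := [ffun j => (j == i)%:R].

End DirectSum.

Record linear_cycle_set (H : zmodType) := LinearCycleSet {
  dot : H -> H -> H;
  dotV : H -> H -> H;
  dotK : forall h, cancel (dot h) (dotV h);
  dotVK : forall h, cancel (dotV h) (dot h);
  dotDr : forall h l m, dot h (l + m) = dot h l + dot h m;
  dotDl : forall h l m, dot (h + l) m = dot (dot h l) (dot h m)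
}.

Definition atimes (H : zmodType) (L : linear_cycle_set H) (h l : H) : H :=
  h + dotV L h l.

Section LinearCycleSetTheory.
Variables (H : zmodType) (L : linear_cycle_set H).
Implicit Types h l m : H.

Lemma dotr0 h : dot L h 0 = 0.
Proof. by apply: (addrI (dot L h 0)); rewrite -dotDr !addr0. Qed.

Lemma dot0l h : dot L 0 h = h.
Proof.
by apply: (can_inj (dotK L 0)); have := dotDl L 0 0 h; rewrite addr0 dotr0.
Qed.

Lemma dotVDr h l m : dotV L h (l + m) = dotV L h l + dotV L h m.
Proof. by apply: (can_inj (dotK L h)); rewrite dotDr !dotVK. Qed.

Lemma dotVr0 h : dotV L h 0 = 0.
Proof. by apply: (can_inj (dotK L h)); rewrite dotVK dotr0. Qed.

Lemma dotV0l h : dotV L 0 h = h.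
Proof. by rewrite -{1}[h]dot0l dotK. Qed.

Lemma dot_atimes h l m : dot L (atimes L h l) m = dot L l (dot L h m).
Proof. by rewrite /atimes dotDl dotVK. Qed.

Lemma dotV_atimes h l m : dotV L (atimes L h l) m = dotV L h (dotV L l m).
Proof.
by apply: (can_inj (dotK L (atimes L h l))); rewrite dotVK dot_atimes !dotVK.
Qed.

Lemma atimesA : associative (atimes L).
Proof. by move=> h l m; rewrite {1 3}/atimes dotV_atimes /atimes dotVDr addrA. Qed.

Lemma atimes0l : left_id 0 (atimes L).
Proof. by move=> h; rewrite /atimes dotV0l add0r. Qed.

Lemma atimesr0 : right_id 0 (atimes L).
Proof. by move=> h; rewrite /atimes dotVr0 addr0. Qed.

Definition ainv h : H := dot L h (- h).

Lemma atimesV : right_inverse 0 ainv (atimes L).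
Proof. by move=> h; rewrite /atimes /ainv dotK subrr. Qed.

Lemma atimesVl : left_inverse 0 ainv (atimes L).
Proof.
move=> h; rewrite -[X in atimes L _ X = _]atimesr0 -(atimesV (ainv h)).
by rewrite (atimesA h) atimesV atimes0l atimesV.
Qed.

End LinearCycleSetTheory.

(* The adjoint group (H, x), as a MathComp group on the carrier of H. *)
Definition adjoint (H : finZmodType) (L : linear_cycle_set H) : Type := H.

HB.instance Definition _ (H : finZmodType) (L : linear_cycle_set H) :=
  Finite.on (adjoint L).
HB.instance Definition _ (H : finZmodType) (L : linear_cycle_set H) :=
  Finite_isGroup.Build (adjoint L)
    (@atimesA _ L) (@atimes0l _ L) (@atimesVl _ L).

Definition apow (H : finZmodType) (L : linear_cycle_set H) (h : H) (k : nat)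
  : H := ((h : adjoint L) ^+ k)%g.

(* The exponentiation y^h of the source is y - prec y h. *)
Record lcs_action (H : zmodType) (L : linear_cycle_set H) (I : zmodType) :=
  LcsAction {
  dia : H -> I -> I;
  prec : I -> H -> I;
  triM : forall h l y,
    let tri z k := dia k (z - prec z k) in
    tri y (atimes L h l) = tri (tri y h) l;
  triD : forall h y z,
    let tri x k := dia k (x - prec x k) in
    tri (y + z) h = tri y h + tri z h;
  tri0 : forall y, dia 0 (y - prec y 0) = y;
  diaM : forall h l y, dia (atimes L l h) y = dia h (dia l y);
  diaD : forall h y z, dia h (y + z) = dia h y + dia h z;
  dia0 : forall y, dia 0 y = y;
  precD : forall h l y,
    (y - prec y (h + l)) + y = (y - prec y h) + (y - prec y l);
  prec0 : forall h, 0 - prec 0 h = 0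
}.

Section ActionTheory.
Variables (H : zmodType) (L : linear_cycle_set H) (I : zmodType).
Variable A : lcs_action L I.
Implicit Types (h l : H) (x y z : I).

Lemma diaB h : {morph dia A h : y z / y - z}.
Proof. by move=> y z; apply: (canRL (addrK _)); rewrite -diaD subrK. Qed.

Lemma dia_inj h : injective (dia A h).
Proof.
apply: (can_inj (g := dia A (ainv L h))) => y.
by rewrite -diaM atimesV dia0.
Qed.

Lemma precDl h y z : prec A (y + z) h = prec A y h + prec A z h.
Proof.
have := triD A h y z; rewrite /= -diaD => /dia_inj /eqP.
by rewrite addrACA -opprD (inj_eq (addrI _)) eqr_opp => /eqP.
Qed.

Lemma precB h : {morph (prec A)^~ h : y z / y - z}.
Proof. by move=> y z /=; apply: (canRL (addrK _)); rewrite -precDl subrK. Qed.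

Lemma diar0 h : dia A h 0 = 0.
Proof. by have := diaB h 0 0; rewrite !subrr. Qed.

Lemma prec0l h : prec A 0 h = 0.
Proof. by have /eqP := prec0 A h; rewrite sub0r oppr_eq0 => /eqP. Qed.

End ActionTheory.

Section Cohomology.
Variables (H : finZmodType) (L : linear_cycle_set H).
Variables (I : zmodType) (A : lcs_action L I).
Implicit Types h l m : H.

Local Notation "h ∙ l" := (dot L h l) (at level 40, left associativity).
Local Notation "h ⋄ y" := (dia A h y) (at level 40, left associativity).
Local Notation "y ≺ h" := (prec A y h) (at level 40, left associativity).

Definition cochain2 : Type :=
  ({ffun H * H -> I} * {ffun H * H -> I})%type.
HB.instance Definition _ := GRing.Zmodule.on cochain2.

Definition normalized (g : {ffun H * H -> I}) : Prop :=
  forall h, g (h, 0) = 0 /\ g (0, h) = 0.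

Record is_cocycle (b g : {ffun H * H -> I}) : Prop := IsCocycle {
  cocycle_C02 : normalized b /\ (forall h l, b (h, l) = b (l, h));
  cocycle_C11 : normalized g;
  cocycle_i : forall h l m,
    b (l, m) - b (h + l, m) + b (h, l + m) - b (h, l) = 0;
  cocycle_ii : forall h l m,
    b (h ∙ l, h ∙ m) - h ⋄ b (l, m) - g (h, m) + g (h, l + m) - g (h, l) = 0;
  cocycle_iii : forall h l m,
    g (h ∙ l, h ∙ m) - g (h + l, m) + (h ∙ l) ⋄ g (h, m)
      + ((h ∙ l) ⋄ g (h, l)) ≺ ((h + l) ∙ m)
      + ((h + l) ⋄ b (h, l)) ≺ ((h + l) ∙ m) = 0
}.

Definition cocycles : {pred cochain2} := fun z => `[< is_cocycle z.1 z.2 >].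

Fact cocycles_zmod_closed : zmod_closed cocycles.
Proof.
split.
  apply/asboolP; split=> [|h|h l m|h l m|h l m].
  - by split=> [h|h l]; rewrite !ffunE.
  - by rewrite !ffunE.
  - by rewrite !ffunE !subr0 addr0.
  - by rewrite !ffunE diar0 !subr0 addr0.
  - by rewrite !ffunE !diar0 !prec0l subr0 !addr0.
move=> [b g] [b' g'] /asboolP[/= [nb sb] ng c1 c2 c3].
move=> /asboolP[/= [nb' sb'] ng' c1' c2' c3'].
apply/asboolP; split=> /= [|h|h l m|h l m|h l m].
- split=> [h|h l]; last by rewrite !ffunE sb sb'.
  by case: (nb h) (nb' h) => p q [p' q']; rewrite !ffunE p q p' q' subr0.
- by case: (ng h) (ng' h) => p q [p' q']; rewrite !ffunE p q p' q' subr0.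
- rewrite -[RHS](subrr 0) -{1}(c1 h l m) -(c1' h l m).
  by do ?[apply: subr_eqB | apply: addr_eqB]; rewrite !ffunE.
- rewrite -[RHS](subrr 0) -{1}(c2 h l m) -(c2' h l m).
  by do ?[apply: subr_eqB | apply: addr_eqB]; rewrite ?ffunE ?diaB.
- rewrite -[RHS](subrr 0) -{1}(c3 h l m) -(c3' h l m).
  by do ?[apply: subr_eqB | apply: addr_eqB]; rewrite ?ffunE ?diaB ?precB.
Qed.

HB.instance Definition _ :=
  GRing.isZmodClosed.Build cochain2 cocycles cocycles_zmod_closed.

Record Z2 := MkZ2 { Z2_val : cochain2; _ : Z2_val \in cocycles }.
HB.instance Definition _ := [isSub for Z2_val].
HB.instance Definition _ := [Choice of Z2 by <:].
HB.instance Definition _ := [SubChoice_isSubZmodule of Z2 by <:].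

(* The element of H acting on t h in the last summand of a coboundary is
   w h l.  The formula of the source is the case w h l = l, for which a
   coboundary need not be a cocycle: take H = Z/6 with h ∙ l = l, I = Z/9,
   h ⋄ y = (-1)^h y, y ≺ h = 3 h y, and t with t 1 = 1.  The case w h l = h is
   the change (b, g) undergoes, in an extension of H by I, when a section s is
   replaced by s + t; these are always cocycles. *)
Definition coboundary (w : H -> H -> H) (t : {ffun H -> I}) : cochain2 :=
  ([ffun p => t p.2 - t (p.1 + p.2) + t p.1],
   [ffun p => t (p.1 ∙ p.2) - p.1 ⋄ t p.2
                - (w p.1 p.2 ⋄ t p.1) ≺ (p.1 ∙ p.2)]).

Definition B2 (w : H -> H -> H) : {pred Z2} := fun z =>
  `[< exists t : {ffun H -> I}, t 0 = 0 /\ val z = coboundary w t >].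

Fact coboundaryB w : {morph coboundary w : t t' / t - t'}.
Proof.
move=> t t'; congr (_, _); apply/ffunP=> p; rewrite !ffunE.
  by apply: addr_eqB => //; apply: subr_eqB.
by do ![apply: subr_eqB]; rewrite ?diaB ?precB.
Qed.

Fact B2_zmod_closed w : zmod_closed (B2 w).
Proof.
split.
  apply/asboolP; exists 0; split; first by rewrite ffunE.
  by rewrite (morphB0 (coboundaryB w)).
move=> z z' /asboolP[t [t0 zt]] /asboolP[t' [t'0 zt']].
apply/asboolP; exists (t - t'); rewrite !ffunE t0 t'0 subrr; split=> //.
by rewrite coboundaryB -zt -zt'.
Qed.

HB.instance Definition _ w :=
  GRing.isZmodClosed.Build Z2 (B2 w) (B2_zmod_closed w).

Definition H2 (w : H -> H -> H) : zmodType := Quotient.quot (B2 w).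

End Cohomology.

Arguments B2 {H L I} A w.

Section Kernel.
Variables (n s : nat) (d : 'I_n -> nat).
Variable L : linear_cycle_set (zsum d).
Variables (I : zmodType) (A : lcs_action L I).
Variable a : 'I_s -> zsum d.
Implicit Types (h m v : zsum d) (j : 'I_s).

Local Notation "h ∙ l" := (dot L h l) (at level 40, left associativity).
Local Notation "h ⋄ y" := (dia A h y) (at level 40, left associativity).
Local Notation "y ≺ h" := (prec A y h) (at level 40, left associativity).
Local Notation "h ⊠ l" := (atimes L h l) (at level 40, left associativity).
Local Notation e := (basis d).
Local Notation r j := #[a j : adjoint L]%g.

(* I^n (+) I^{sn}: x.1 0 i is gamma_i and x.2 j i is f_{ji}. *)
Definition params : Type := ('rV[I]_n * 'M[I]_(s, n))%type.
HB.instance Definition _ := GRing.Zmodule.on params.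
Implicit Types x : params.

Definition alpha (gamma : 'rV[I]_n) (h l : zsum d) : I :=
  \sum_(i < n | (d i <= h i + l i)%N) gamma 0 i.

Definition f1 x j v : I :=
  \sum_(i < n) x.2 j i *+ v i
  + \sum_(i < n) \sum_(1 <= l < v i)
      alpha x.1 (a j ∙ e i) ((a j ∙ e i) *+ l)
  + \sum_(k < n | (0 < k)%N)
      alpha x.1 (\sum_(i < n | (i < k)%N) (a j ∙ e i) *+ v i)
                ((a j ∙ e k) *+ v k).

Definition F1 x j (k : 'I_s) v : I :=
  f1 x k (a j ∙ v) + a k ⋄ f1 x j v
  + (a k ⋄ f1 x j (dotV L (a j) (a k))) ≺ ((a j ⊠ a k) ∙ v)
  - ((a j ⊠ a k) ⋄ alpha x.1 (a j) (dotV L (a j) (a k))) ≺ ((a j ⊠ a k) ∙ v).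

Definition abar j (l : nat) : zsum d := apow L (a j) l.+1 - a j.

Definition T1 x : 'M[I]_(s, n) := \matrix_(j, i)
  (x.2 j i *+ d i
   + \sum_(1 <= k < d i) alpha x.1 (a j ∙ e i) ((a j ∙ e i) *+ k)
   - a j ⋄ x.1 0 i).

Definition T2 x : 'M[I]_(s, n) := \matrix_(j, i)
  (\sum_(0 <= l < r j)
     apow L (a j) (r j - 1 - l) ⋄ f1 x j (apow L (a j) l ∙ e i)
   + \sum_(1 <= l < r j) (apow L (a j) l ⋄ f1 x j (abar j l)) ≺ e i
   - \sum_(1 <= l < r j)
       (apow L (a j) l.+1 ⋄ alpha x.1 (a j) (abar j l)) ≺ e i).

Definition T3 x : {ffun {p : 'I_s * 'I_s | (p.1 < p.2)%N} * 'I_n -> I} :=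
  [ffun q => let: (p, k) := q in let: (i, j) := val p in
     F1 x j i (e k) - F1 x i j (e k)].

(* For w see the coboundaries above; the formula of the source is the case
   w h l = l. *)
Definition Smap (w : zsum d -> zsum d -> zsum d) (t : 'rV[I]_n) : params :=
  (\row_i (t 0 i *+ d i),
   \matrix_(j, i) (- (\sum_(k < n) t 0 k *+ (a j ∙ e i) k) + a j ⋄ t 0 i
      + \sum_(k < n) ((w (a j) (e i) ⋄ t 0 k) ≺ (a j ∙ e i)) *+ (a j) k)).

Definition kerT : {pred params} := fun x =>
  [&& T1 x == 0, T2 x == 0 & T3 x == 0].

Fact alphaB gamma gamma' h l :
  alpha (gamma - gamma') h l = alpha gamma h l - alpha gamma' h l.
Proof. by apply: sumr_eqB => i; rewrite !mxE. Qed.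

Fact f1B x x' j v : f1 (x - x') j v = f1 x j v - f1 x' j v.
Proof.
do ![apply: addr_eqB].
- by apply: sumr_eqB => i; rewrite !mxE mulrnBl.
- by apply: sumr_eqB => i; apply: sumr_eqB => l; rewrite alphaB.
- by apply: sumr_eqB => k; rewrite alphaB.
Qed.

Fact F1B x x' j k v : F1 (x - x') j k v = F1 x j k v - F1 x' j k v.
Proof.
apply: subr_eqB; last by rewrite alphaB diaB precB.
do 2![apply: addr_eqB; last by rewrite ?f1B ?diaB ?precB].
exact: f1B.
Qed.

Fact T1B : {morph T1 : x y / x - y}.
Proof.
move=> x y; apply/matrixP=> j i; rewrite !mxE.
apply: subr_eqB; last by rewrite ?mxE diaB.
by apply: addr_eqB; [rewrite ?mxE mulrnBl|apply: sumr_eqB => k; rewrite alphaB].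
Qed.

Fact T2B : {morph T2 : x y / x - y}.
Proof.
move=> x y; apply/matrixP=> j i; rewrite !mxE.
by apply: subr_eqB; first apply: addr_eqB; apply: sumr_eqB => l;
  rewrite ?alphaB ?f1B ?diaB ?precB.
Qed.

Fact T3B : {morph T3 : x y / x - y}.
Proof.
move=> x y; apply/ffunP=> -[p k]; rewrite !ffunE; case: (val p) => i j.
by apply: subr_eqB; rewrite F1B.
Qed.

Fact SmapB w : {morph Smap w : t t' / t - t'}.
Proof.
move=> t t'; congr (_, _); apply/matrixP=> j i; rewrite !mxE.
  by rewrite mulrnBl.
do ![apply: addr_eqB].
- by apply: oppr_eqB; apply: sumr_eqB => k; rewrite !mxE mulrnBl.
- by rewrite diaB.
- by apply: sumr_eqB => k; rewrite ?mxE diaB precB mulrnBl.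
Qed.

Fact kerT_zmod_closed : zmod_closed kerT.
Proof.
split.
  by rewrite unfold_in (morphB0 T1B) (morphB0 T2B) (morphB0 T3B) !eqxx.
move=> x y; rewrite !unfold_in T1B T2B T3B.
case/and3P=> /eqP-> /eqP-> /eqP-> /and3P[/eqP-> /eqP-> /eqP->].
by rewrite !subrr !eqxx.
Qed.

HB.instance Definition _ := GRing.isZmodClosed.Build params kerT kerT_zmod_closed.

Record K := MkK { K_val : params; _ : K_val \in kerT }.
HB.instance Definition _ := [isSub for K_val].
HB.instance Definition _ := [Choice of K by <:].
HB.instance Definition _ := [SubChoice_isSubZmodule of K by <:].

Definition imS (w : zsum d -> zsum d -> zsum d) : {pred K} := fun x : K =>
  `[< exists t : 'rV[I]_n, val x = Smap w t >].

Fact imS_zmod_closed w : zmod_closed (imS w).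
Proof.
split; first by apply/asboolP; exists 0; rewrite (morphB0 (SmapB w)).
move=> x x' /asboolP[t xt] /asboolP[t' xt'].
by apply/asboolP; exists (t - t'); rewrite SmapB -xt -xt'.
Qed.

HB.instance Definition _ w :=
  GRing.isZmodClosed.Build K (imS w) (imS_zmod_closed w).

Definition is_f x (f : {ffun zsum d * zsum d -> I}) : Prop :=
  (forall j v, f (a j, v) = f1 x j v) /\
  (forall l m v,
     f (l ⊠ m, v) =
       f (m, l ∙ v) + m ⋄ f (l, v)
       + (m ⋄ f (l, dotV L l m)) ≺ ((l ⊠ m) ∙ v)
       - ((l ⊠ m) ⋄ alpha x.1 l (dotV L l m)) ≺ ((l ⊠ m) ∙ v)).

Definition alpha_cochain x : {ffun zsum d * zsum d -> I} :=
  [ffun p => alpha x.1 p.1 p.2].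

Definition T_induces_isomorphism (w : zsum d -> zsum d -> zsum d) : Prop :=
  (forall t, Smap w t \in kerT) /\
  exists T : {additive K -> Z2 A},
    (forall x : K, exists f,
       unique (is_f (val x)) f /\ val (T x) = (alpha_cochain (val x), - f)) /\
    exists Tbar : {additive Quotient.quot (imS w) -> H2 A w},
      (forall x : K, Tbar (\pi_(Quotient.quot (imS w)) x)
                       = \pi_(Quotient.quot (B2 A w)) (T x)) /\ bijective Tbar.

End Kernel.

(* Main.v *)
(* A cocycle (b, -f) describes an extension of H by I: b is the factor set of its
   additive group, and f h is the translation part of an additive lift of
   l |-> h ∙ l to that group. Choosing lifts of the e_i, and lifting v to the sum
   of v_i copies of the lift of e_i, replaces b by alpha_gamma up to a coboundary.
   For b = alpha_gamma, the pairs (h, F), with F the translation part of an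
   additive lift of l |-> h ∙ l, form a monoid over (H, x), and condition (iii)
   says that h |-> (h, f h) is a homomorphic section. T1 vanishes iff the pairs
   q_j = (a_j, f1 a_j) belong to this monoid; then T2 vanishes iff the q_j have
   the orders r_j of the a_j, and T3 vanishes iff they commute. As (H, x) is the
   direct product of the <a_j>, this is exactly what is needed for a_j |-> q_j to
   extend to a section. Finally, S(t) corresponds to the coboundary of the map
   v |-> sum_i v_i t_i, and these are the only coboundaries with b = alpha_gamma. *)
Require Import Defs.
From HB Require Import structures.
From mathcomp Require Import all_boot all_order all_algebra all_fingroup.
From mathcomp Require Import generic_quotient ring_quotient boolp zify cyclic.

Set Implicit Arguments.
Unset Strict Implicit.
Unset Printing Implicit Defensive.

Import GRing.Theory.

(** * Extensions with a given factor set *)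

Section FactorSets.
Local Open Scope ring_scope.

Record factor_set (H I : zmodType) := FactorSet {
  fs_fun :> H -> H -> I;
  fs0l : forall h, fs_fun 0 h = 0;
  fsC : forall h l, fs_fun h l = fs_fun l h;
  fsA : forall h l m,
    fs_fun h l + fs_fun (h + l) m = fs_fun l m + fs_fun h (l + m)
}.

Lemma fs0r (H I : zmodType) (b : factor_set H I) h : b h 0 = 0.
Proof. by rewrite fsC fs0l. Qed.

(* b only serves to select the addition of the extension defined below. *)
Definition ext (H I : zmodType) (b : factor_set H I) : Type := (I * H)%type.
HB.instance Definition _ (H I : zmodType) (b : factor_set H I) :=
  Choice.copy (ext b) (I * H)%type.
Definition Ext (H I : zmodType) (b : factor_set H I) (y : I) (h : H) : ext b :=
  (y, h).

Section Extension.
Variables (H I : zmodType) (b : factor_set H I).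
Local Notation ext := (ext b).
Local Notation Ext := (Ext b).

Definition ext_add (x y : ext) : ext := (x.1 + y.1 + b x.2 y.2, x.2 + y.2).
Definition ext_opp (x : ext) : ext := (- x.1 - b (- x.2) x.2, - x.2).

Fact ext_addA : associative ext_add.
Proof.
move=> [x h] [y l] [z m]; rewrite /ext_add /=; congr (_, _); last exact: addrA.
by rewrite -!addrA [b h l + _]addrCA fsA.
Qed.
Fact ext_addC : commutative ext_add.
Proof.
by move=> [x h] [y l]; rewrite /ext_add /= fsC (addrC x) (addrC h).
Qed.
Fact ext_add0 : left_id ((0, 0) : ext) ext_add.
Proof. by move=> [x h]; rewrite /ext_add /= fs0l !add0r addr0. Qed.
Fact ext_addN : left_inverse ((0, 0) : ext) ext_opp ext_add.
Proof.
by move=> [x h]; rewrite /ext_add /ext_opp /= addNr addrAC subrK addNr.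
Qed.

HB.instance Definition _ :=
  GRing.isZmodule.Build ext ext_addA ext_addC ext_add0 ext_addN.

Lemma ExtD (y z : I) (h l : H) :
  Ext y h + Ext z l = Ext (y + z + b h l) (h + l).
Proof. by []. Qed.

Lemma ExtD0 (y z : I) h : Ext y h + Ext z 0 = Ext (y + z) h.
Proof. by rewrite ExtD fs0r !addr0. Qed.

Lemma Ext_sum0 n (P : pred 'I_n) (y : 'I_n -> I) :
  \sum_(i | P i) Ext (y i) 0 = Ext (\sum_(i | P i) y i) 0.
Proof.
by apply/esym/(big_morph (fun z => Ext z 0)) => // z z'; rewrite ExtD0.
Qed.

(** Copies are added one at a time, and each addition contributes one value of [b]. For
    [h = a_j ∙ e_i] these are the inner sums in [f1] and, with [k = d_i], the sum in [T1]. *)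
Lemma Ext_muln y h k :
  Ext y h *+ k = Ext (y *+ k + \sum_(1 <= l < k) b h (h *+ l)) (h *+ k).
Proof.
elim: k => [|k IHk]; first by rewrite big_geq // addr0.
rewrite mulrSr IHk ExtD !mulrSr; congr Ext; case: k {IHk} => [|k].
  by rewrite !big_geq // mulr0n fs0l !addr0.
by rewrite [in RHS]big_nat_recr //= fsC addrA [_ + y]addrAC.
Qed.

(** Summing from left to right pairs each partial sum with the next term, which is the shape of the
    last summand of [f1]. *)
Lemma Ext_sum n (y : 'I_n -> I) (h : 'I_n -> H) :
  \sum_i Ext (y i) (h i) =
  Ext (\sum_i y i
       + \sum_(k < n | (0 < k)%N) b (\sum_(i < n | (i < k)%N) h i) (h k))
      (\sum_i h i).
Proof.
elim: n y h => [|n IHn] y h; first by rewrite !big_ord0 addr0.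
rewrite !big_ord_recr /= IHn ExtD; congr Ext.
rewrite [_ + y _]addrAC -[LHS]addrA; congr (_ + _).
rewrite [RHS]big_mkcond big_ord_recr -big_mkcond /=.
congr (_ + _).
  apply: eq_bigr => k _; congr (b _ _).
  by rewrite [RHS]big_mkcond big_ord_recr /= ltnNge ltnW //= addr0 -big_mkcond.
(* The filter [0 < k] removes the last index only if it is also the first; its term would be
   [b 0 _], which is 0. *)
case: n {IHn} y h => [|n] y h; first by rewrite !big_ord0 fs0l.
congr (b _ _); rewrite [RHS]big_mkcond [RHS]big_ord_recr /= ltnn addr0.
by apply: eq_bigr => i _; rewrite ltn_ord.
Qed.

End Extension.

Section MorphSum.
Variables (U V : zmodType) (f : U -> V).
Hypothesis fD : {morph f : u v / u + v}.

Lemma morphD0 : f 0 = 0.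
Proof. by apply: (addrI (f 0)); rewrite -fD !addr0. Qed.

Lemma morph_muln u k : f (u *+ k) = f u *+ k.
Proof. by elim: k => [|k IHk]; rewrite ?morphD0 // !mulrS fD IHk. Qed.

Lemma morph_sum_muln n (x : 'I_n -> U) (k : 'I_n -> nat) :
  f (\sum_i x i *+ k i) = \sum_i f (x i) *+ k i.
Proof.
rewrite (big_morph f fD morphD0); apply: eq_bigr => i _; exact: morph_muln.
Qed.

End MorphSum.

End FactorSets.

(** * Carries in the direct sum and the factor set alpha *)

Section DirectSum.
Local Open Scope ring_scope.
Variables (n : nat) (d : 'I_n -> nat).
Hypothesis hd : forall i, (1 < d i)%N.
Implicit Types h l m v : zsum d.

Lemma zsum_coord_lt h i : (h i < d i)%N.
Proof. by rewrite -[X in (_ < X)%N]Zp_cast. Qed.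

Lemma zsumD_coord h l i :
  (h i + l i)%N = ((h + l)%R i + (d i <= h i + l i) * d i)%N.
Proof.
have -> : (h + l)%R i = ((h i + l i) %% d i)%N :> nat.
  by rewrite ffunE; congr (_ %% _)%N; apply: Zp_cast.
case: leqP => [le_d|lt_d]; last by rewrite modn_small // addn0.
rewrite -{2}(subnK le_d) modnDr modn_small ?mul1n ?subnK //.
by move: (zsum_coord_lt h i) (zsum_coord_lt l i); lia.
Qed.

(** Passing to the representatives of [h + l] loses [d i] at each carry. This serves both for [E]
    with values in [I] and for [E] with values in an extension. *)
Lemma sum_carry (V : zmodType) (E : 'I_n -> V) h l :
  \sum_i E i *+ h i + \sum_i E i *+ l i =
  \sum_i E i *+ (h + l)%R i + \sum_(i | (d i <= h i + l i)%N) E i *+ d i.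
Proof.
rewrite -big_split [X in _ + X]big_mkcond -big_split /=; apply: eq_bigr => i _.
by rewrite -mulrnDr [in LHS]zsumD_coord mulrnDr; case: ifP => _; rewrite ?mul1n.
Qed.

Lemma zsum0_coord i : (0 : zsum d) i = 0 :> nat.
Proof. by rewrite ffunE. Qed.

Lemma basisE i j : basis d i j = (j == i) :> nat.
Proof. by rewrite ffunE; case: eqP. Qed.

Lemma sum_basis v : \sum_i basis d i *+ v i = v.
Proof.
apply/ffunP=> j; have sumE (F : 'I_n -> zsum d) : (\sum_i F i) j = \sum_i F i j.
  by apply: (big_morph (fun h : zsum d => h j)) => [h l|]; rewrite ffunE.
have mulnE (h : zsum d) k : (h *+ k) j = h j *+ k.
  by elim: k => [|k IHk]; rewrite ?mulr0n ?ffunE // !mulrS ffunE IHk.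
rewrite sumE (bigD1 j) //= big1 => [|i ne_ij]; rewrite mulnE ffunE ?eqxx.
  by rewrite addr0 mulr1n Zp_nat valZpK.
by rewrite eq_sym (negPf ne_ij) mul0rn.
Qed.

Lemma partial_sum_basis_coord (P : pred 'I_n) v j :
  (\sum_(i | P i) basis d i *+ v i) j = (P j * v j)%N :> nat.
Proof.
pose w : zsum d := [ffun i => if P i then v i else 0].
have wE i : w i = (P i * v i)%N :> nat.
  by rewrite ffunE; case: (P i); rewrite ?mul1n.
suff -> : \sum_(i | P i) basis d i *+ v i = w by [].
rewrite -[w]sum_basis big_mkcond.
by apply: eq_bigr => i _; rewrite wE; case: (P i); rewrite ?mul1n.
Qed.

Lemma basis_muln_d i : basis d i *+ d i = 0.
Proof.
apply/ffunP=> j; have mulnE k : (basis d i *+ k) j = basis d i j *+ k.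
  by elim: k => [|k IHk]; rewrite ?mulr0n ?ffunE // !mulrS ffunE IHk ffunE.
rewrite mulnE !ffunE; case: eqP => [->|_]; last by rewrite mul0rn.
by rewrite pchar_Zp.
Qed.

Lemma basis_muln_coord i k j : (k < d i)%N ->
  (basis d i *+ k) j = ((j == i) * k)%N :> nat.
Proof.
elim: k => [|k IHk] lt_k; first by rewrite zsum0_coord muln0.
move: (zsumD_coord (basis d i) (basis d i *+ k) j) (hd j).
have {}IHk := IHk (ltnW lt_k).
rewrite -mulrS basisE IHk => + /ltnW dj.
case: eqP => [ji|_]; rewrite ?mul1n ?mul0n ?add1n ?addn0 leqNgt.
  by rewrite ji lt_k addn0 => <-.
by rewrite dj addn0 => <-.
Qed.

Section Alpha.
Variables (I : zmodType) (gamma : 'rV[I]_n).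

Lemma alphaE h l :
  alpha gamma h l = \sum_i gamma 0 i *+ (d i <= h i + l i)%N.
Proof. by rewrite /alpha big_mkcond; apply: eq_bigr => i _; case: ifP. Qed.

Fact alpha0l h : alpha gamma 0 h = 0.
Proof.
rewrite alphaE big1 // => i _.
by rewrite zsum0_coord add0n leqNgt zsum_coord_lt.
Qed.

Fact alphaC h l : alpha gamma h l = alpha gamma l h.
Proof. by rewrite /alpha; apply: eq_bigl => i; rewrite addnC. Qed.

Fact alphaA h l m :
  alpha gamma h l + alpha gamma (h + l) m =
  alpha gamma l m + alpha gamma h (l + m).
Proof.
rewrite !alphaE -!big_split /=; apply: eq_bigr => i _; rewrite -!mulrnDr.
(* Multiplied by [d i], both carry counts equal the sum of the three representatives minus the
   representative of the coordinate of [h + l + m]. *)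
congr (_ *+ _); apply/eqP; rewrite -(eqn_pmul2r (ltnW (hd i))) !mulnDl.
move: (zsumD_coord h l i) (zsumD_coord (h + l) m i).
move: (zsumD_coord l m i) (zsumD_coord h (l + m) i).
rewrite addrA; do 4!(move: (_ * _)%N => ?).
by do 6!(move: (nat_of_ord _) => ?); lia.
Qed.

Definition alpha_fs := FactorSet alpha0l alphaC alphaA.

Lemma alpha_eq0 h l :
  (forall i, (h i + l i < d i)%N) -> alpha gamma h l = 0.
Proof. by move=> hl; rewrite /alpha big_pred0 // => i; rewrite leqNgt hl. Qed.

Lemma Ext_basis_muln i k : (k < d i)%N ->
  Ext alpha_fs 0 (basis d i) *+ k = Ext alpha_fs 0 (basis d i *+ k).
Proof.
move=> lt_k; rewrite Ext_muln mul0rn add0r big_nat big1 // => l /andP[_ lt_l].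
apply: alpha_eq0 => j.
rewrite basis_muln_coord ?basisE; last exact: ltn_trans lt_l lt_k.
by case: eqP (hd j) => [->|_] hj; rewrite ?mul1n ?mul0n //; lia.
Qed.

(** Only the last of the [d i] copies produces a carry, so [gamma 0 i] can be read off from the lift
    of [e_i]. *)
Lemma Ext_basis_muln_d i :
  Ext alpha_fs 0 (basis d i) *+ d i = Ext alpha_fs (gamma 0 i) 0.
Proof.
have d_gt0 := ltnW (hd i); rewrite -{1}(prednK d_gt0) mulrS.
rewrite Ext_basis_muln ?prednK // ExtD -mulrS prednK // basis_muln_d add0r.
rewrite add0r /= /alpha (bigD1 i) /=; last first.
  by rewrite basis_muln_coord ?prednK // basisE eqxx mul1n add1n prednK.
rewrite big1 ?addr0 // => j /andP[le_dj /negPf ne_ji]; move: le_dj.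
by rewrite basis_muln_coord ?prednK // basisE ne_ji leqNgt ltnW.
Qed.

(** No carry occurs when [v] is assembled from its coordinates. An additive map on the extension is
    therefore known at [Ext 0 v] from its values at the lifts of the [e_i]. *)
Lemma Ext_sum_basis v :
  Ext alpha_fs 0 v = \sum_i Ext alpha_fs 0 (basis d i) *+ v i.
Proof.
under eq_bigr do rewrite Ext_basis_muln ?zsum_coord_lt //.
rewrite Ext_sum sum_basis big1 // add0r big1 // => k _.
apply: alpha_eq0 => j; rewrite partial_sum_basis_coord.
rewrite basis_muln_coord ?zsum_coord_lt //.
case: eqP => [->|_]; first by rewrite ltnn mul1n zsum_coord_lt.
by rewrite addn0; case: (j < k)%N; rewrite ?mul1n ?zsum_coord_lt // ltnW.
Qed.

End Alpha.
End DirectSum.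

(** * The monoid of additive lifts *)

Section ActionIdentities.
Local Open Scope ring_scope.
Variables (H : zmodType) (L : linear_cycle_set H) (I : zmodType).
Variable A : lcs_action L I.
Implicit Types (h l : H) (x y z : I).

Local Notation "h ∙ l" := (dot L h l) (at level 40, left associativity).
Local Notation "h ⋄ y" := (dia A h y) (at level 40, left associativity).
Local Notation "y ≺ h" := (prec A y h) (at level 40, left associativity).
Local Notation "h ⊠ l" := (atimes L h l) (at level 40, left associativity).

Lemma diaN h y : h ⋄ (- y) = - (h ⋄ y).
Proof. by rewrite -[- y]sub0r diaB diar0 sub0r. Qed.

Lemma precN h y : (- y) ≺ h = - (y ≺ h).
Proof. by rewrite -[- y]sub0r precB prec0l sub0r. Qed.

Lemma precDr y h l : y ≺ (h + l) = y ≺ h + y ≺ l.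
Proof.
by have := precD A h l y; rewrite addrAC addrACA -opprD => /addrI/oppr_inj.
Qed.

Lemma precr0 y : y ≺ 0 = 0.
Proof. by apply: (addrI (y ≺ 0)); rewrite -precDr !addr0. Qed.

Lemma atimes_dot h l : h ⊠ (h ∙ l) = h + l.
Proof. by rewrite /atimes dotK. Qed.

Lemma diaDl h l y : (h + l) ⋄ y = (h ∙ l) ⋄ (h ⋄ y).
Proof. by rewrite -diaM atimes_dot. Qed.

(* Expand the right action of h + l = h ⊠ (h ∙ l) in two ways. *)
Lemma dia_prec h l y : h ⋄ (y ≺ l) = (h ⋄ (y - y ≺ h)) ≺ (h ∙ l).
Proof.
have := triM A h (h ∙ l) y; rewrite /= atimes_dot diaDl => /dia_inj.
by rewrite precDr opprD addrA [h ⋄ (_ - _ - _)]diaB => /addrI/oppr_inj.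
Qed.

End ActionIdentities.

Section Lifts.
Local Open Scope ring_scope.
Variables (H : finZmodType) (L : linear_cycle_set H) (I : zmodType).
Variables (A : lcs_action L I) (b : factor_set H I).
Implicit Types (h l m p : H) (F G : {ffun H -> I}).

Local Notation "h ∙ l" := (dot L h l) (at level 40, left associativity).
Local Notation "h ⋄ y" := (dia A h y) (at level 40, left associativity).
Local Notation "y ≺ h" := (prec A y h) (at level 40, left associativity).
Local Notation "h ⊠ l" := (atimes L h l) (at level 40, left associativity).

(* (y, l) |-> (h ⋄ y + F l, h ∙ l) is additive on the extension of H by I. *)
Definition twisted h F : Prop := forall l m,
  F (l + m) + h ⋄ b l m = F l + F m + b (h ∙ l) (h ∙ m).

(* In the adjoint group of the extension, the product of the lifts of h and m
   differs from the lift of h ⊠ m by an element of I, which is - corr h m F;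
   lift_comp divides the product by this element. *)
Definition corr h m F : I := m ⋄ F (dotV L h m) - (h ⊠ m) ⋄ b h (dotV L h m).

Definition lift_comp h m F G : {ffun H -> I} :=
  [ffun l => G (h ∙ l) + m ⋄ F l + corr h m F ≺ ((h ⊠ m) ∙ l)].

Lemma twisted0 h F : twisted h F -> F 0 = 0.
Proof.
move=> /(_ 0 0); rewrite dotr0 !fs0l diar0 !addr0 => /esym/eqP.
by rewrite -subr_eq0 addrK => /eqP.
Qed.

Lemma twisted_comp h m F G :
  twisted h F -> twisted m G -> twisted (h ⊠ m) (lift_comp h m F G).
Proof.
move=> tF tG l l'; rewrite !ffunE diaM !dotDr precDr !dot_atimes.
apply: (addIr (m ⋄ b (h ∙ l) (h ∙ l'))).
rewrite [LHS](AC (2*2*1*1) ((1*6)*(2*5)*(3*4))) /= tG -diaD tF !diaD.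
by rewrite [RHS](AC (3*3*1*1) ((1*4*7)*(2*5*8)*(3*6))).
Qed.

(** The coefficients of [≺] on the two sides of associativity. The last summand is what [dia_prec]
    yields when [p] acts on [corr h m F ≺ _]. *)
Lemma corr_assoc h m p F G : twisted h F ->
  corr h (m ⊠ p) F + corr m p G =
  corr (h ⊠ m) p (lift_comp h m F G)
  + p ⋄ (corr h m F - corr h m F ≺ p).
Proof.
move=> tF; rewrite {1 2 3}/corr !ffunE dotVK [RHS]addrAC -diaD.
rewrite [_ + (corr h m F - _)]addrCA -addrA.
rewrite addrCA addrK dotV_atimes dotVK.
have -> : dotV L h (m ⊠ p) = dotV L h m + dotV L h (dotV L m p).
  exact: dotVDr.
set x := dotV L h m; set y := dotV L h _; set y' := dotV L m p.
(* What remains after removing the actions of [p] and [m]: it combines [tF] at [x] and [y], where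
   [h ∙ x = m] and [h ∙ y = y'], with the cocycle identity of [b] at [h, x, y], where
   [h + x = h ⊠ m]. *)
have key : F (x + y) - h ⋄ b h (x + y) - b m y' =
    F x - h ⋄ b h x + F y - h ⋄ b (h ⊠ m) y.
  apply: (addIr (h ⋄ b x y)).
  rewrite [LHS]addrAC [_ + h ⋄ b x y in LHS]addrAC tF !dotVK.
  rewrite [_ + b m y' - _]addrAC addrK -/x -[h ⊠ m]/(h + x).
  have -> : b h (x + y) = b h x + b (h + x) y - b x y.
    by rewrite fsA addrAC subrr add0r.
  rewrite diaB diaD !opprD opprK !addrA.
  by rewrite [RHS](AC 5 (1*3*2*4*5)).
have -> : forall u v, - (h ⊠ (m ⊠ p) ⋄ u) + ((m ⊠ p) ⋄ F (x + y) +
     (p ⋄ G y' - (m ⊠ p) ⋄ v)) = p ⋄ (m ⋄ (F (x + y) - h ⋄ u - v) + G y').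
  move=> u v; rewrite !(diaD, diaN, diaM).
  by rewrite [LHS](AC (1*(1*2)) ((2*1*4)*3)).
rewrite key diaM -diaB; congr (p ⋄ _).
rewrite /corr -/x !diaM !(diaD, diaN).
by rewrite [RHS](AC (2*2*1) (1*2*4*5*3)).
Qed.

Lemma lift_compA h m p F G K : twisted h F -> twisted m G ->
  lift_comp h (m ⊠ p) F (lift_comp m p G K) =
  lift_comp (h ⊠ m) p (lift_comp h m F G) K.
Proof.
move=> tF tG; apply/ffunP=> l; rewrite !ffunE.
rewrite !diaD dia_prec -!dot_atimes diaM !atimesA.
rewrite [LHS](AC 5 ((1*2*4)*(5*3))) /= -precDl corr_assoc // precDl.
by rewrite [RHS](AC (1*3*1) ((1*2*3)*(5*4))).
Qed.

Lemma corrr0 h F : twisted h F -> corr h 0 F = 0.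
Proof. by move=> /twisted0 F0; rewrite /corr dotVr0 F0 fs0r !diar0 subrr. Qed.

Lemma lift_comp0l m G : lift_comp 0 m 0 G = G.
Proof.
apply/ffunP=> l; rewrite !ffunE /corr ffunE fs0l !diar0 subrr prec0l.
by rewrite dot0l !addr0.
Qed.

Lemma lift_comp0r h F : twisted h F -> lift_comp h 0 F 0 = F.
Proof.
move=> tF; apply/ffunP=> l; rewrite !ffunE corrr0 // prec0l.
by rewrite dia0 add0r addr0.
Qed.

Lemma twisted_zero : twisted 0 0.
Proof. by move=> l m; rewrite !ffunE dia0 !dot0l !add0r. Qed.

(** The condition is made boolean so that lifts form a subtype: equality is equality of the pairs,
    and the choice structure needed for a monoid is inherited. *)
Record lifting := Lifting {
  lift_val : H * {ffun H -> I};
  _ : `[< twisted lift_val.1 lift_val.2 >]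
}.
HB.instance Definition _ := [isSub for lift_val].
HB.instance Definition _ := [Choice of lifting by <:].

Definition lift_base (q : lifting) : H := (val q).1.
Definition lift_fun (q : lifting) : {ffun H -> I} := (val q).2.
Definition mk_lift h F (tF : twisted h F) : lifting :=
  @Lifting (h, F) (asboolT tF).

Lemma liftP q : twisted (lift_base q) (lift_fun q).
Proof. exact/asboolP/(valP q). Qed.

Lemma lift_eq q q' :
  lift_base q = lift_base q' -> lift_fun q = lift_fun q' -> q = q'.
Proof. by move=> ? ?; apply: val_inj; apply: injective_projections. Qed.

Definition lift_mul q q' : lifting :=
  mk_lift (twisted_comp (liftP q) (liftP q')).
Definition lift_one : lifting := mk_lift twisted_zero.

Fact lift_mulA : associative lift_mul.
Proof.
move=> q q' q''; apply: lift_eq; first exact: atimesA.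
by apply: lift_compA; apply: liftP.
Qed.
Fact lift_mul1 : left_id lift_one lift_mul.
Proof.
by move=> q; apply: lift_eq; [exact: atimes0l | exact: lift_comp0l].
Qed.
Fact lift_mulr1 : right_id lift_one lift_mul.
Proof.
move=> q; apply: lift_eq; first exact: atimesr0.
exact: lift_comp0r (liftP q).
Qed.

HB.instance Definition _ :=
  isMonoid.Build lifting lift_mulA lift_mul1 lift_mulr1.

Lemma apowS h k : apow L h k.+1 = h ⊠ apow L h k.
Proof. by rewrite /apow expgS. Qed.

Lemma lift_baseX (q : lifting) k :
  lift_base (q ^+ k)%g = apow L (lift_base q) k.
Proof. by elim: k => // k IHk; rewrite expgS apowS -IHk. Qed.

(** For [k] the order of the base element this becomes the formula of [T2]. *)
Lemma lift_funX (q : lifting) k v :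
  lift_fun (q ^+ k)%g v =
  \sum_(0 <= l < k) apow L (lift_base q) (k - 1 - l)
                      ⋄ lift_fun q (apow L (lift_base q) l ∙ v)
  + \sum_(1 <= l < k) corr (lift_base q) (apow L (lift_base q) l) (lift_fun q)
                        ≺ (apow L (lift_base q) k ∙ v).
Proof.
elim: k v => [|k IHk] v; first by rewrite !big_geq // addr0 ffunE.
rewrite expgS [LHS]ffunE -/(lift_base _) -/(lift_fun _) IHk lift_baseX.
rewrite big_nat_recl // subn0 subn1 /= dot0l.
rewrite -!dot_atimes -apowS -addrA addrAC -[in RHS]addrA [RHS]addrCA -addrA.
congr (_ + _).
  apply: eq_big_nat => l /andP[_ lt_lk]; rewrite apowS dot_atimes.
  congr (apow _ _ _ ⋄ _); lia.
rewrite subn1 /= -addrA; congr (_ + _); case: k {IHk} => [|k].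
  (* The first factor only adds the correction against the neutral element, which vanishes; hence
     the sum of corrections starts at 1. *)
  by rewrite !big_geq // addr0 corrr0 ?prec0l //; apply: liftP.
by rewrite [in RHS]big_nat_recr //= addrC.
Qed.

End Lifts.

(** * Homomorphisms out of a direct product of cyclic groups *)

Section CyclicDecomposition.
Local Open Scope group_scope.
Variables (s : nat) (gT : finGroupType) (a : 'I_s -> gT).
Hypothesis dprod_a : \big[dprod/1]_(j < s) <[a j]> = [set: gT].
Hypothesis comm_a : forall i j, commute (a i) (a j).

Lemma cyclic_decomp x : exists k : 'I_s -> nat, x = \prod_j a j ^+ k j.
Proof.
have [c [ac -> _]] := mem_bigdprod dprod_a (in_setT x).
have /fin_all_exists[k kc] j : exists k, c j = a j ^+ k by apply/cycleP/ac.
by exists k; apply: eq_bigr.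
Qed.

Lemma cyclic_decomp_inj (k k' : 'I_s -> nat) :
  \prod_j a j ^+ k j = \prod_j a j ^+ k' j ->
  forall j, a j ^+ k j = a j ^+ k' j.
Proof.
move=> eq_kk' j.
have [c [_ _ cP]] := mem_bigdprod dprod_a (in_setT (\prod_j a j ^+ k j)).
by rewrite (cP (fun j => a j ^+ k j)) ?(cP (fun j => a j ^+ k' j)) // => *;
  apply: mem_cycle.
Qed.

Lemma cyclic_decomp_ind (P : gT -> Prop) :
    P 1 -> (forall x y, P x -> P y -> P (x * y)) -> (forall j, P (a j)) ->
  forall x, P x.
Proof.
move=> P1 PM Pa x; have [k ->] := cyclic_decomp x.
apply: (big_ind P) => // j _.
by elim: (k j) => // m; rewrite expgS; apply: PM.
Qed.

(** Each exponent is unique modulo the order of [a j], and [q j] satisfies the same power relation,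
    so the product of the [q j ^+ k j] does not depend on the chosen exponents. As the [q j]
    commute, it is multiplicative. *)
Lemma cyclic_decomp_extend (M : monoidType) (q : 'I_s -> M) :
    (forall j, q j ^+ #[a j] = 1) -> (forall i j, commute (q i) (q j)) ->
  exists X : gT -> M,
    [/\ X 1 = 1, {morph X : x y / x * y} & forall j, X (a j) = q j].
Proof.
move=> qX comm_q; have [k kP] := choice cyclic_decomp.
have qE (m m' : 'I_s -> nat) :
    \prod_j a j ^+ m j = \prod_j a j ^+ m' j ->
  \prod_j q j ^+ m j = \prod_j q j ^+ m' j.
  move/cyclic_decomp_inj => eq_a; apply: eq_bigr => j _.
  have /eqP := eq_a j; rewrite eq_expg_mod_order => /eqP eq_mod.
  have qmod i : q j ^+ i = q j ^+ (i %% #[a j]).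
    by rewrite {1}(divn_eq i #[a j]) expgnDr mulnC expgnA qX expg1n mul1g.
  by rewrite qmod eq_mod -qmod.
have aD (m m' : 'I_s -> nat) : \prod_j a j ^+ (m j + m' j) =
    \prod_j a j ^+ m j * \prod_j a j ^+ m' j.
  under eq_bigr do rewrite expgnDr.
  by apply: prodgM_commute => i j _ _; apply: commuteX2.
exists (fun x => \prod_j q j ^+ k x j); split=> [|x y|j].
- by rewrite (qE _ (fun=> 0%N)) -?kP big1.
- rewrite (qE _ (fun j => k x j + k y j)%N); last by rewrite aD -!kP.
  under eq_bigr do rewrite expgnDr.
  by apply: prodgM_commute => i j _ _; apply: commuteX2.
(* Exponents given by the Kronecker delta write [a j] itself as a product. *)
- have delta (N : monoidType) (z : 'I_s -> N) : \prod_i z i ^+ (i == j) = z j.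
    under eq_bigr do rewrite expgb.
    by rewrite -big_mkcond big_pred1_eq.
  by rewrite (qE _ (fun i => i == j)) ?delta // -kP.
Qed.

End CyclicDecomposition.

(** * Isomorphisms between quotient groups *)

Section QuotientIso.
Local Open Scope ring_scope.
Local Open Scope quotient_scope.

(** The first hypothesis gives both well-definedness and injectivity, the second surjectivity. *)
Lemma quot_iso (U V : zmodType) (S : zmodClosed U) (B : zmodClosed V)
    (T : {additive U -> V}) :
    (forall x, (T x \in B) = (x \in S)) ->
    (forall z, exists x, z - T x \in B) ->
  exists Tbar : {additive Quotient.quot S -> Quotient.quot B},
    (forall x, Tbar (\pi_(Quotient.quot S) x) = \pi_(Quotient.quot B) (T x))
    /\ bijective Tbar.
Proof.
move=> T_inj T_surj.
have piE x y : (\pi_(Quotient.quot B) (T x) == \pi_(Quotient.quot B) (T y)) =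
    (\pi_(Quotient.quot S) x == \pi_(Quotient.quot S) y).
  by rewrite -!Quotient.idealrBE -raddfB T_inj.
pose f u := \pi_(Quotient.quot B) (T (repr (u : Quotient.quot S))).
have fE x : f (\pi_(Quotient.quot S) x) = \pi_(Quotient.quot B) (T x).
  by apply/eqP; rewrite piE reprK.
have fB : zmod_morphism f.
  move=> u v; elim/quotW: u => x; elim/quotW: v => y.
  by rewrite -raddfB !fE !raddfB.
pose fA : {additive _ -> _} := HB.pack f (GRing.isZmodMorphism.Build _ _ f fB).
exists fA; split=> //.
have f_surj v : exists u, f u = v.
  elim/quotW: v => z; have [x zx] := T_surj z.
  by exists (\pi x); rewrite fE; apply/esym/eqP; rewrite -Quotient.idealrBE.
have [g gK] := choice f_surj; exists g => // u; apply/eqP.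
elim/quotW: u => x; rewrite -[fA _]/(f _) fE -[g _]reprK -piE.
exact/eqP/gK.
Qed.

End QuotientIso.

(** * Cocycles as sections of the monoid of lifts *)

Section CocyclesAsLifts.
Local Open Scope ring_scope.
Variables (H : finZmodType) (L : linear_cycle_set H) (I : zmodType).
Variables (A : lcs_action L I) (b : factor_set H I).
Implicit Types (h l m : H) (f : {ffun H * H -> I}).

Local Notation "h ∙ l" := (dot L h l) (at level 40, left associativity).
Local Notation "h ⋄ y" := (dia A h y) (at level 40, left associativity).
Local Notation "y ≺ h" := (prec A y h) (at level 40, left associativity).
Local Notation "h ⊠ l" := (atimes L h l) (at level 40, left associativity).

Definition slice f h : {ffun H -> I} := [ffun l => f (h, l)].

Lemma slice_comp f h m v :
  lift_comp A b h m (slice f h) (slice f m) v =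
    f (m, h ∙ v) + m ⋄ f (h, v) + (m ⋄ f (h, dotV L h m)) ≺ ((h ⊠ m) ∙ v)
    - ((h ⊠ m) ⋄ b h (dotV L h m)) ≺ ((h ⊠ m) ∙ v).
Proof. by rewrite !ffunE /corr precB !ffunE addrA. Qed.

(** At [h = m = 0] multiplicativity leaves [f (0, 0) ≺ v + f (0, v) = 0]; taking [v = 0] kills
    [f (0, 0)], and then every [f (0, v)]. *)
Lemma slice0 f :
    (forall h m, slice f (h ⊠ m) = lift_comp A b h m (slice f h) (slice f m)) ->
  slice f 0 = 0.
Proof.
move=> fM; have f0 v : f (0, 0) ≺ v + f (0, v) = 0.
  have := slice_comp f 0 0 v; rewrite -fM atimes0l ffunE dotVr0.
  rewrite fs0l diar0 prec0l subr0 !dia0 !dot0l -addrA => /eqP.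
  by rewrite -{1}[f _]addr0 (inj_eq (addrI _)) addrC eq_sym => /eqP.
have f00 : f (0, 0) = 0 by rewrite -[RHS](f0 0) precr0 add0r.
by apply/ffunP=> v; rewrite !ffunE -[RHS](f0 v) f00 prec0l add0r.
Qed.

(** Condition (ii) for [- f] is twistedness, and (iii) with [l] replaced by [dotV L h m] is
    multiplicativity; [E2] and [E3] only move terms across the equality. The factor set laws give
    the conditions on [b], while [twisted0] and [slice0] give the normalization of [f]. *)
Lemma cocycle_lift f :
  is_cocycle A [ffun p => b p.1 p.2] (- f) <->
  (forall h, twisted A b h (slice f h)) /\
  (forall h m, slice f (h ⊠ m) = lift_comp A b h m (slice f h) (slice f m)).
Proof.
have E2 (u v w x y : I) : (x + v == y + w + u) = (u - v + w - x + y == 0).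
  rewrite eq_sym -subr_eq0 opprD !addrA.
  by rewrite (AC 5 (3*5*2*4*1)).
have E3 (p q r t u : I) :
    (q == p + r + t - u) = (- p + q - r - t + u == 0).
  rewrite -subr_eq0 !opprD opprK !addrA.
  by rewrite (AC 5 (2*1*3*4*5)).
split=> [[_ _ _ c2 c3]|[tf cf]].
  split=> [h l m|h m].
    by rewrite !ffunE; apply/eqP; rewrite E2 -(c2 h l m) !ffunE !opprK.
  apply/ffunP=> v; rewrite slice_comp ffunE; apply/eqP; rewrite E3.
  rewrite -(c3 h (dotV L h m) v) !ffunE !opprK dotVK -[h + _]/(h ⊠ m).
  by rewrite !diaN !precN.
have f0 h : f (h, 0) = 0 by have := twisted0 (tf h); rewrite ffunE.
have f0l v : f (0, v) = 0 by have /ffunP/(_ v) := slice0 cf; rewrite !ffunE.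
split=> [|h|h l m|h l m|h l m].
- by split=> [h|h l]; rewrite !ffunE /= ?fs0l ?fs0r // fsC.
- by rewrite !ffunE f0 f0l oppr0.
- by rewrite !ffunE /= [b l m - _ + _]addrAC -fsA addrK subrr.
- apply/eqP; rewrite !ffunE !opprK -E2.
  by have := tf h l m; rewrite !ffunE => ->.
have := slice_comp f h (h ∙ l) m; rewrite -cf ffunE atimes_dot dotK => /eqP.
by rewrite E3 !ffunE opprK !diaN !precN => /eqP.
Qed.

End CocyclesAsLifts.

(** * The kernels of T1, T2, T3 and the cocycles with factor set alpha *)

Section KernelAndCocycles.
Local Open Scope ring_scope.
Variables (n s : nat) (d : 'I_n -> nat).
Hypothesis hd : forall i, (1 < d i)%N.
Variables (L : linear_cycle_set (zsum d)) (I : zmodType) (A : lcs_action L I).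
Variable a : 'I_s -> adjoint L.
Implicit Types (h l m v : zsum d) (j : 'I_s) (x : params n s I).

Local Notation "h ∙ l" := (dot L h l) (at level 40, left associativity).
Local Notation "h ⋄ y" := (dia A h y) (at level 40, left associativity).
Local Notation "y ≺ h" := (prec A y h) (at level 40, left associativity).
Local Notation "h ⊠ l" := (atimes L h l) (at level 40, left associativity).
Local Notation e := (basis d).
Local Notation fs x := (alpha_fs hd x.1).

(** The factor set terms cancel in [F - G], which is therefore additive and determined on the [e_i].
    Equalities of lifts thus reduce to the entries of [T2] and [T3]. *)
Lemma twisted_basis (b : factor_set (zsum d) I) h (F G : {ffun zsum d -> I}) :
  twisted A b h F -> twisted A b h G -> (forall i, F (e i) = G (e i)) -> F = G.
Proof.
move=> tF tG eqFG; pose D v := F v - G v.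
have DD : {morph D : u v / u + v}.
  move=> u v; rewrite /D; apply: (addIr (h ⋄ b u v - h ⋄ b u v)).
  rewrite {2}subrr addr0 addrACA -opprD tF tG.
  by rewrite !opprD addrACA subrr addr0 addrACA.
apply/ffunP=> v; apply/eqP; rewrite -subr_eq0 -[_ - _]/(D v) -[v]sum_basis.
rewrite (morph_sum_muln DD) big1 // => i _.
by rewrite /D eqFG subrr mul0rn.
Qed.

Lemma dot_sum_basis h v : h ∙ v = \sum_i (h ∙ e i) *+ v i.
Proof. by rewrite -{1}[v]sum_basis (morph_sum_muln (dotDr L h)). Qed.

(** This is the origin of [f1]: its value is the [I]-component of the combination, with coefficients
    [v i], of the chosen lifts of the [a j ∙ e i]. *)
Lemma f1_Ext x j v :
  Ext (fs x) (f1 L a x j v) (a j ∙ v) =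
  \sum_i Ext (fs x) (x.2 j i) (a j ∙ e i) *+ v i.
Proof.
under eq_bigr do rewrite Ext_muln.
by rewrite Ext_sum -dot_sum_basis big_split.
Qed.

Lemma f1_basis x j i : f1 L a x j (e i) = x.2 j i.
Proof.
have := f1_Ext x j (e i); rewrite (bigD1 i) //= big1 => [|k /negPf ki].
  by rewrite basisE eqxx mulr1n addr0 => /(congr1 fst).
by rewrite basisE ki.
Qed.

Lemma T1_Ext x j i :
  Ext (fs x) (x.2 j i) (a j ∙ e i) *+ d i =
  Ext (fs x) (T1 A a x j i + a j ⋄ x.1 0 i) 0.
Proof.
rewrite Ext_muln mxE subrK; congr Ext.
by rewrite -(morph_muln (dotDr L _)) basis_muln_d // dotr0.
Qed.

(** By [f1_Ext] the failure of additivity is a sum of [d i]-fold multiples over the carries; when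
    [T1] vanishes, these multiples are the [a j ⋄ gamma_i], which add up to [a j ⋄ alpha l m]. *)
Lemma twisted_f1 x j :
  T1 A a x = 0 -> twisted A (fs x) (a j) [ffun v => f1 L a x j v].
Proof.
move=> T1x l m; rewrite !ffunE.
suff: Ext (fs x) (f1 L a x j (l + m) + a j ⋄ fs x l m) (a j ∙ (l + m)) =
      Ext (fs x) (f1 L a x j l) (a j ∙ l) + Ext (fs x) (f1 L a x j m) (a j ∙ m).
  by rewrite ExtD => /(congr1 fst).
rewrite -ExtD0 !f1_Ext sum_carry //; congr (_ + _).
rewrite /= /alpha (big_morph (dia A (a j)) (diaD A (a j)) (diar0 A (a j))).
by rewrite -Ext_sum0; apply: eq_bigr => i _; rewrite T1_Ext T1x mxE add0r.
Qed.

Section TwistedAtGenerator.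
Variables (x : params n s I) (j : 'I_s) (F : {ffun zsum d -> I}).
Hypotheses (tF : twisted A (fs x) (a j) F) (Fe : forall i, F (e i) = x.2 j i).

Let phi (p : ext (fs x)) := Ext (fs x) (a j ⋄ p.1 + F p.2) (a j ∙ p.2).

Let phiD : {morph phi : p q / p + q}.
Proof.
move=> [y l] [z m]; rewrite /phi ExtD /= dotDr; congr Ext.
rewrite !diaD -[LHS]addrA [_ + F (l + m)]addrC tF.
by rewrite [LHS](AC (2*3) ((1*3)*(2*4)*5)).
Qed.

(** The additive map [phi] is evaluated on the decomposition of [Ext 0 v] into lifts of the
    [e_i]. *)
Lemma twisted_f1E v : F v = f1 L a x j v.
Proof.
suff: phi (Ext (fs x) 0 v) = Ext (fs x) (f1 L a x j v) (a j ∙ v).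
  by rewrite /phi /= diar0 add0r => /(congr1 fst).
rewrite Ext_sum_basis (morph_sum_muln phiD) f1_Ext.
by apply: eq_bigr => i _; rewrite /phi /= diar0 add0r Fe.
Qed.

(** Applying [phi] to the [d i]-fold multiple of the lift of [e_i] gives [a j ⋄ gamma_i] on one side
    and the left side of [T1_Ext] on the other. *)
Lemma twisted_T1 i : T1 A a x j i = 0.
Proof.
have phi_e : phi (Ext (fs x) 0 (e i)) = Ext (fs x) (x.2 j i) (a j ∙ e i).
  by rewrite /phi /= diar0 add0r Fe.
have := T1_Ext x j i; rewrite -phi_e -(morph_muln phiD) Ext_basis_muln_d //.
rewrite /phi /= (twisted0 tF) addr0 => /(congr1 fst) /= /eqP.
by rewrite -subr_eq0 opprD addrCA subrr addr0 oppr_eq0 => /eqP.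
Qed.

End TwistedAtGenerator.

Lemma F1_lift x j k v :
  F1 A a x j k v =
  lift_comp A (fs x) (a j) (a k)
    [ffun v => f1 L a x j v] [ffun v => f1 L a x k v] v.
Proof. by rewrite /F1 !ffunE /corr precB ffunE addrA. Qed.

(** The power has base element 0, which acts trivially on [e i], so all corrections sit in front of
    [≺ e i]; and [abar] is the argument [dotV L (a j) _] occurring in [corr]. *)
Lemma T2_lift x j i (q : lifting A (fs x)) :
    lift_base q = a j -> lift_fun q = [ffun v => f1 L a x j v] ->
  T2 A a x j i = lift_fun (q ^+ #[a j])%g (e i).
Proof.
move=> qa qf; rewrite lift_funX mxE qa qf.
have -> : apow L (a j) #[a j]%g = 0 by rewrite /apow expg_order.
rewrite -addrA dot0l -sumrB; congr (_ + _).
  by apply: eq_bigr => l _; rewrite ffunE.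
apply: eq_bigr => l _; rewrite /corr precB ffunE -apowS.
suff -> : dotV L (a j) (apow L (a j) l) = abar L a j l by [].
by rewrite /abar apowS /atimes addrC addKr.
Qed.

Hypothesis dprod_a : (\big[dprod/1]_(j < s) <[a j]>)%g = [set: adjoint L].
Hypothesis abelian_L : abelian [set: adjoint L].

Let comm_a i j : commute (a i) (a j).
Proof. by move/centsP: abelian_L; apply; rewrite inE. Qed.

Lemma is_fP x f :
  is_f A a x f <->
  (forall j v, f (a j, v) = f1 L a x j v) /\
  (forall h m,
     slice f (h ⊠ m) = lift_comp A (fs x) h m (slice f h) (slice f m)).
Proof.
split=> -[fa fM]; split=> // h m.
  by apply/ffunP=> v; rewrite slice_comp ffunE fM.
by move=> v; rewrite -(slice_comp A (fs x)) -fM ffunE.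
Qed.

Lemma is_f_inj x f f' : is_f A a x f -> is_f A a x f' -> f = f'.
Proof.
move=> /is_fP[fa fM] /is_fP[fa' fM'].
suff eq_slice h : slice f h = slice f' h.
  by apply/ffunP=> -[h v]; have /ffunP/(_ v) := eq_slice h; rewrite !ffunE.
elim/(cyclic_decomp_ind dprod_a): h => [|h m IHh IHm|j].
- by rewrite (slice0 fM) (slice0 fM').
- by rewrite fM fM' IHh IHm.
by apply/ffunP=> v; rewrite !ffunE fa fa'.
Qed.

Lemma is_f_exists x : x \in kerT A a ->
  exists f, is_f A a x f /\ forall h, twisted A (fs x) h (slice f h).
Proof.
case/and3P=> /eqP T1x /eqP T2x /eqP T3x.
pose q j := mk_lift (twisted_f1 j T1x).
have qX j : (q j ^+ #[a j] = 1)%g.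
  have base0 : lift_base (q j ^+ #[a j])%g = 0.
    by rewrite lift_baseX /apow expg_order.
  apply: lift_eq => //; apply: twisted_basis.
  - exact: liftP.
  - rewrite base0; exact: (liftP (1%g : lifting A (fs x))).
  - by move=> i; rewrite -T2_lift // T2x mxE ffunE.
(* [T3] only records the pairs with [i < j]; the other pairs follow by symmetry. *)
have comm_lt (i j : 'I_s) : (i < j)%N -> commute (q i) (q j).
  move=> ij; have base_eq : lift_base (q i * q j)%g = lift_base (q j * q i)%g.
    exact: comm_a.
  apply: lift_eq => //; apply: twisted_basis.
  - exact: liftP.
  - rewrite base_eq; exact: liftP.
  - move=> k; have : T3 A a x (Sub (i, j) ij, k) = 0 by rewrite T3x ffunE.
    by rewrite [T3 _ _ _ _]ffunE /= !F1_lift => /eqP; rewrite subr_eq0 => /eqP.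
have comm_q i j : commute (q i) (q j).
  have [/comm_lt//|/comm_lt/commute_sym//|/val_inj->//] := ltngtP i j.
have [X [X1 XM Xa]] := cyclic_decomp_extend dprod_a comm_a qX comm_q.
have Xbase h : lift_base (X h) = h.
  elim/(cyclic_decomp_ind dprod_a): h => [|h m IHh IHm|j].
  - by rewrite X1.
  - by rewrite XM -[RHS]/(h ⊠ m) -{2}IHh -{2}IHm.
  by rewrite Xa.
pose f : {ffun zsum d * zsum d -> I} := [ffun p => lift_fun (X p.1) p.2].
have fE h : slice f h = lift_fun (X h) by apply/ffunP=> v; rewrite !ffunE.
exists f; split=> [|h]; last by rewrite fE -{1}[h]Xbase; apply: liftP.
apply/is_fP; split=> [j v|h m]; first by rewrite ffunE Xa ffunE.
have XMhm : X (h ⊠ m) = (X h * X m)%g := XM h m.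
rewrite !fE XMhm; transitivity (lift_comp A (fs x) (lift_base (X h))
  (lift_base (X m)) (lift_fun (X h)) (lift_fun (X m))); first by [].
by rewrite !Xbase.
Qed.

(** The slices of [f] form a homomorphic section [X], and the relations are transported along it:
    the order of [a j] gives [T2], commutativity of the adjoint group gives [T3]. Additivity of the
    single lifts gives [T1]. *)
Lemma lift_kerT x f :
    (forall h, twisted A (fs x) h (slice f h)) ->
    (forall h m,
      slice f (h ⊠ m) = lift_comp A (fs x) h m (slice f h) (slice f m)) ->
    (forall j i, f (a j, e i) = x.2 j i) ->
  is_f A a x f /\ x \in kerT A a.
Proof.
move=> tf fM fe.
have fa j v : f (a j, v) = f1 L a x j v.
  rewrite -(twisted_f1E (tf (a j))) ?ffunE // => i.
  by rewrite ffunE.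
have sa j : slice f (a j) = [ffun v => f1 L a x j v].
  by apply/ffunP=> v; rewrite !ffunE.
split; first exact/is_fP.
pose X h := mk_lift (tf h).
have XM h m : X (h ⊠ m) = (X h * X m)%g by apply: lift_eq; rewrite ?[LHS]fM.
have X1 : X 0 = 1%g.
  by apply: lift_eq; rewrite //= [LHS](slice0 fM).
have XX h k : (X h ^+ k)%g = X (apow L h k).
  by elim: k => [|k IHk]; rewrite ?X1 // expgS IHk apowS XM.
apply/and3P; split; apply/eqP.
- apply/matrixP=> j i; rewrite (twisted_T1 (tf (a j))) ?mxE // => k.
  by rewrite ffunE.
- apply/matrixP=> j i; rewrite (T2_lift i (q := X (a j)) (erefl _) (sa j)) XX.
  by rewrite /apow expg_order X1 mxE ffunE.
apply/ffunP=> -[[[i j] ij] k]; rewrite !ffunE /= !F1_lift -!sa -!fM.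
have -> : a i ⊠ a j = a j ⊠ a i by exact: comm_a.
by rewrite subrr.
Qed.

Lemma is_fB x x' f f' :
  is_f A a x f -> is_f A a x' f' -> is_f A a (x - x') (f - f').
Proof.
case=> fa fM [fa' fM']; split=> [j v|l m v]; first by rewrite f1B !ffunE fa fa'.
rewrite !ffunE fM fM'; apply/esym/subr_eqB; last by rewrite alphaB diaB precB.
by do 2![apply: addr_eqB; last by rewrite ?diaB ?precB].
Qed.

Lemma alpha_cochain_fs x : alpha_cochain d x = [ffun p => fs x p.1 p.2].
Proof. by apply/ffunP=> p; rewrite !ffunE. Qed.

Lemma cocycle_kerT x f :
    is_cocycle A (alpha_cochain d x) (- f) ->
    (forall j i, f (a j, e i) = x.2 j i) ->
  is_f A a x f /\ x \in kerT A a.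
Proof.
by rewrite alpha_cochain_fs => /cocycle_lift[tf fM] /lift_kerT; apply.
Qed.

Lemma is_f_cocycle x f :
  x \in kerT A a -> is_f A a x f -> is_cocycle A (alpha_cochain d x) (- f).
Proof.
move=> /is_f_exists[f' [xf' tf']] xf; rewrite (is_f_inj xf xf').
by rewrite alpha_cochain_fs; apply/cocycle_lift; split=> //; case/is_fP: xf'.
Qed.

Lemma kerT_to_cocycles : exists T : {additive K A a -> Z2 A},
  forall x : K A a, exists f,
    unique (is_f A a (val x)) f /\ val (T x) = (alpha_cochain d (val x), - f).
Proof.
have /choice[T TP] (x : K A a) : exists z : Z2 A,
    is_f A a (val x) (- (val z).2) /\ (val z).1 = alpha_cochain d (val x).
  have [f [xf _]] := is_f_exists (valP x).
  have /asboolT zP := is_f_cocycle (valP x) xf.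
  by exists (MkZ2 (Z2_val := (_, _)) zP); rewrite /= opprK.
(* Additivity follows from uniqueness: [f - f'] satisfies the defining equations for [x - y]. *)
have TB : zmod_morphism T.
  move=> x y; apply: val_inj; rewrite [RHS]raddfB.
  have [[xf xa] [yf ya]] := (TP x, TP y); have [xyf xya] := TP (x - y).
  apply: injective_projections; rewrite [RHS]/=.
    by rewrite xa ya xya raddfB; apply/ffunP=> p; rewrite !ffunE alphaB.
  apply: oppr_inj; rewrite opprD; apply: is_f_inj xyf _.
  by rewrite raddfB; apply: is_fB.
pose TA : {additive _ -> _} := HB.pack T (GRing.isZmodMorphism.Build _ _ T TB).
exists TA => x; have [xf xa] := TP x; exists (- (val (T x)).2); split.
  by split=> // f; apply: is_f_inj.
by rewrite opprK -xa; apply: injective_projections.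
Qed.

(** * Coboundaries and the image of S *)

Section Coboundaries.
Variable w : zsum d -> zsum d -> zsum d.
Hypothesis wP : forall t : {ffun zsum d -> I},
  t 0 = 0 -> coboundary A w t \in cocycles A.

Section SmapCoboundary.
Variable t : 'rV[I]_n.
Let tt : {ffun zsum d -> I} := [ffun v : zsum d => \sum_i t 0 i *+ v i].

Lemma lin0 : tt 0 = 0.
Proof. by rewrite ffunE big1 // => i _; rewrite zsum0_coord. Qed.

Lemma lin_basis i : tt (e i) = t 0 i.
Proof.
rewrite ffunE (bigD1 i) //= big1 => [|k /negPf ki]; rewrite basisE ?ki //.
by rewrite eqxx addr0.
Qed.

(** [tt] is linear in the representatives, so it fails to be additive only through carries, each
    costing [t 0 i *+ d i]. *)
Lemma coboundary_lin1 : (coboundary A w tt).1 = alpha_cochain d (Smap A a w t).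
Proof.
apply/ffunP=> -[h l]; rewrite !ffunE /= addrAC [X in X - _]addrC sum_carry //.
by rewrite addrAC subrr add0r; apply: eq_bigr => i _; rewrite mxE.
Qed.

Lemma coboundary_lin2 j i :
  - (coboundary A w tt).2 (a j, e i) = (Smap A a w t).2 j i.
Proof.
rewrite ffunE lin_basis mxE !opprD !opprK ![tt _]ffunE /=.
congr (_ + _ + _).
have wD : {morph (fun y => (w (a j) (e i) ⋄ y) ≺ (a j ∙ e i)) : y z / y + z}.
  by move=> y z; rewrite diaD precDl.
by rewrite (morph_sum_muln wD).
Qed.

(** The image of [S] lies in the kernels because the coboundary of [tt] is a cocycle by [wP]; the
    equations of [T1], [T2], [T3] need no separate computation. *)
Lemma Smap_is_f :
  is_f A a (Smap A a w t) (- (coboundary A w tt).2)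
  /\ Smap A a w t \in kerT A a.
Proof.
apply: cocycle_kerT => [|j i]; last by rewrite ffunE coboundary_lin2.
rewrite opprK -coboundary_lin1; exact/asboolP/wP/lin0.
Qed.

End SmapCoboundary.

(** The hypothesis says that [psi] is an additive retraction of the extension onto [I]; its values
    on the lifts of the [e_i] and on their multiples give both claims. *)
Lemma coboundary_alpha_lin (t : {ffun zsum d -> I}) gamma :
    t 0 = 0 ->
    (forall h l, t l - t (h + l) + t h = alpha gamma h l) ->
  (forall v, t v = \sum_i t (e i) *+ v i)
  /\ (forall i, t (e i) *+ d i = gamma 0 i).
Proof.
move=> t0 dt; pose psi (p : ext (alpha_fs hd gamma)) := p.1 + t p.2.
have psiD : {morph psi : p q / p + q}.
  move=> [y h] [z l]; rewrite /psi /= -dt.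
  rewrite -[LHS]addrA [t l - _ + _]addrAC subrK [t l + _]addrC.
  exact: addrACA.
have psiE v : psi (Ext (alpha_fs hd gamma) 0 v) = t v by rewrite /psi add0r.
split=> [v|i].
  rewrite -psiE Ext_sum_basis (morph_sum_muln psiD).
  by apply: eq_bigr => i _; rewrite psiE.
by rewrite -psiE -(morph_muln psiD) Ext_basis_muln_d // /psi /= t0 addr0.
Qed.

Lemma coboundary_imS x f (t : {ffun zsum d -> I}) :
    is_f A a x f -> t 0 = 0 -> (alpha_cochain d x, - f) = coboundary A w t ->
  x = Smap A a w (\row_i t (e i)).
Proof.
move=> xf t0 Et; set u := \row_i _.
have [] := @coboundary_alpha_lin t x.1 t0.
  move=> h l; have /(congr1 fst)/ffunP/(_ (h, l)) := Et.
  by rewrite !ffunE /= => ->.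
move=> t_lin t_d.
have Eu : t = [ffun v : zsum d => \sum_i u 0 i *+ v i].
  by apply/ffunP=> v; rewrite ffunE t_lin; apply: eq_bigr => i _; rewrite mxE.
apply: injective_projections; first by apply/rowP=> i; rewrite !mxE t_d.
apply/matrixP=> j i; rewrite -coboundary_lin2 -Eu -Et ffunE opprK.
by rewrite (proj1 xf) f1_basis.
Qed.

(** Surjectivity: every cocycle is moved by a coboundary into the image of [T]. *)
Lemma cocycle_normalize (z : Z2 A) :
  exists (x : K A a) (t : {ffun zsum d -> I}) f,
    [/\ t 0 = 0, is_f A a (val x) f
      & val z - coboundary A w t = (alpha_cochain d (val x), - f)].
Proof.
have /asboolP := valP z; case Ez: (val z) => [b g] /= [[nb bC] _ ci _ _].
have bA h l m : b (h, l) + b (h + l, m) = b (l, m) + b (h, l + m).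
  apply/esym/eqP; rewrite -subr_eq0 -[X in _ == X](ci h l m).
  by rewrite opprD addrA (AC 4 (1*4*2*3)).
pose B := FactorSet (fun h => (nb h).2) bC bA.
(* [v] is lifted to the combination of the lifts [E i] instead of [Ext B 0 v]; [tau] is the
   difference, and [gamma] records the multiples [E i *+ d i], which lie in [I]. *)
pose E i := Ext B 0 (e i); pose tau v := (\sum_i E i *+ v i).1.
pose gamma := \row_i (E i *+ d i).1.
have sndD : {morph (fun p : ext B => p.2) : p q / p + q} by [].
have EdE i : E i *+ d i = Ext B (gamma 0 i) 0.
  apply: injective_projections; first by rewrite mxE.
  by rewrite (morph_muln sndD) basis_muln_d.
have tauE v : \sum_i E i *+ v i = Ext B (tau v) v.
  apply: injective_projections; first by [].
  by rewrite (morph_sum_muln sndD) sum_basis.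
have tauD h l : tau h + tau l + b (h, l) = tau (h + l) + alpha gamma h l.
  have := sum_carry hd E h l; rewrite !tauE ExtD.
  under eq_bigr do rewrite EdE.
  by rewrite Ext_sum0 ExtD0 => /(congr1 fst).
pose t : {ffun zsum d -> I} := [ffun v => - tau v].
have t0 : t 0 = 0.
  by rewrite ffunE /tau big1 ?oppr0 // => i _; rewrite zsum0_coord.
pose f := - (val z - coboundary A w t).2.
(* The second component is forced, since [f1] at [e i] returns the parameter with indices [j] and
   [i]. *)
pose x : params n s I := (gamma, \matrix_(j, i) f (a j, e i)).
have zt : val z - coboundary A w t = (alpha_cochain d x, - f).
  apply: injective_projections; last by rewrite /f opprK.
  rewrite Ez; apply/ffunP=> -[h l]; rewrite !ffunE /=.
  apply: (addrI (tau (h + l))); rewrite -tauD !opprD !opprK.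
  by rewrite [LHS](AC (1*(1*3)) (5*3*2*(1*4))) /= subrr addr0.
have [xf xK] : is_f A a x f /\ x \in kerT A a.
  apply: cocycle_kerT => [|j i]; last by rewrite mxE.
  have : val z - coboundary A w t \in cocycles A.
    by apply: rpredB; [exact: valP | exact: wP].
  by rewrite zt => /asboolP.
by exists (Sub x xK), t, f; rewrite !SubK -Ez.
Qed.

Lemma induces_iso : T_induces_isomorphism A a w.
Proof.
split=> [t|]; first by have [] := Smap_is_f t.
have [T TP] := kerT_to_cocycles; exists T; split=> //.
apply: quot_iso => [x|z].
  have [f [[xf _] Tx]] := TP x.
  apply/asboolP/asboolP => -[t].
    case=> t0 Et; exists (\row_i t (e i)).
    by apply: coboundary_imS xf t0 _; rewrite -Tx.
  move=> Ex; have [xf' _] := Smap_is_f t; rewrite -Ex in xf'.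
  eexists; split; first exact: (lin0 t).
  by rewrite Tx (is_f_inj xf xf') opprK Ex -coboundary_lin1; case: coboundary.
have [x [t [f [t0 xf zt]]]] := cocycle_normalize z; exists x.
have [f' [[xf' _] Tx]] := TP x.
apply/asboolP; exists t; split=> //.
have -> : val (z - T x) = val z - val (T x) by [].
by rewrite Tx (is_f_inj xf' xf) -zt opprB addrCA subrr addr0.
Qed.

End Coboundaries.
End KernelAndCocycles.

(** * Coboundaries with w h l = h *)

Section ShiftCoboundaries.
Local Open Scope ring_scope.
Variables (H : finZmodType) (L : linear_cycle_set H) (I : zmodType).
Variable A : lcs_action L I.

Local Notation "h ∙ l" := (dot L h l) (at level 40, left associativity).
Local Notation "h ⋄ y" := (dia A h y) (at level 40, left associativity).
Local Notation "y ≺ h" := (prec A y h) (at level 40, left associativity).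

(** After expansion the terms cancel in pairs, which the [AC] patterns list. In (iii) this requires
    [dia_prec], which turns the action of [h ∙ l] on [_ ≺ (h ∙ m)] into terms with
    [≺ ((h + l) ∙ m)]. *)
Lemma coboundary_shift_cocycle (t : {ffun H -> I}) :
  t 0 = 0 -> coboundary A (fun h l => h) t \in cocycles A.
Proof.
move=> t0; apply/asboolP; split=> [|h|h l m|h l m|h l m].
- split=> [h|h l]; rewrite !ffunE /=.
    by rewrite addr0 add0r t0 add0r addNr subrr addr0.
  by rewrite addrAC [t l + _]addrC [l + h]addrC [RHS]addrAC.
- rewrite !ffunE /= dotr0 t0 !diar0 precr0 dot0l dia0 prec0l !subr0.
  by rewrite subrr.
- rewrite !ffunE /= !(opprD, opprK, addrA).
  by rewrite (AC 12 ((1*4)*(7*2)*(3*10)*(5*8)*(11*6)*(9*12))) /= !subrr !addr0.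
- rewrite !ffunE /= -dotDr !(diaD, diaN) dotDr precDr !(opprD, opprK, addrA).
  rewrite (AC 16 ((1*7)*(10*2)*(3*14)*(8*4)*(5*11)*(15*6)*(9*13)*(16*12))) /=.
  by rewrite !subrr !addr0.
rewrite !ffunE /= !(diaB, diaD, diaN) [_ ⋄ (_ ≺ (h ∙ m))]dia_prec -dotDl.
rewrite !diaDl !(diaD, diaN, precDl, precN) !(opprD, opprK, addrA).
rewrite
  (AC 16 ((1*4)*(7*2)*(11*3)*(5*8)*(6*15)*(16*9)*(10*13)*(14*12))) /=.
by rewrite !subrr !addr0.
Qed.

End ShiftCoboundaries.

Theorem corollary2p35 (n s : nat) (d : 'I_n -> nat)
    (hd : forall i, (1 < d i)%N)
    (L : linear_cycle_set (zsum d))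
    (I : zmodType) (A : lcs_action L I)
    (a : 'I_s -> adjoint L)
    (habel : abelian [set: adjoint L])
    (hdprod : (\big[dprod/1]_(j < s) <[a j]>)%g = [set: adjoint L]) :
  [/\ (forall t : {ffun zsum d -> I}, t 0%R = 0%R -> coboundary A (fun h l => l) t \in cocycles A) ->
      T_induces_isomorphism A a (fun h l => l),
      forall t : {ffun zsum d -> I}, t 0%R = 0%R -> coboundary A (fun h l => h) t \in cocycles A
    & T_induces_isomorphism A a (fun h l => h)].
Proof.
split; [|exact: coboundary_shift_cocycle|]; first exact: induces_iso.
by apply: induces_iso => //; apply: coboundary_shift_cocycle.
Qed.
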